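(* Let $I\subset\mathbb{R}$ be an interval with interior $I^{\circ}$, let $f:I\to\mathbb{R}$ be twice differentiable on $I^{\circ}$, let $a,b\in I^{\circ}$ with $a<b$, and suppose $f''\in L_1[a,b]$. Let $c,y,d$ be real numbers with $0\le c\le y\le d\le 1$ and $0<y<1$. If $|f''|$ is convex on $[a,b]$, then $$\left|\frac{(c-y)^2-(d-y)^2}{2}(a-b)f'(ya+(1-y)b)+\frac{(d-1)^2f'(a)-c^2f'(b)}{2}(a-b)+(c-d)f(ya+(1-y)b)+\bigl[(d-1)f(a)-cf(b)\bigr]+\frac{1}{b-a}\int_a^b f(x)\,dx\right|\le\frac{(b-a)^2}{24}\bigl(A|f''(a)|+B|f''(b)|\bigr),$$ where $$A=6d^2-8d+3+(6c^2-6d^2)y^2+(8d-8c)y^3$$ and $$B=6d^2-4d+1+(12c^2-12d^2)y+(12d+6d^2-12c-6c^2)y^2+(8c-8d)y^3.$$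
   Context: $L_1[a,b]$ denotes the space of Lebesgue integrable functions on $[a,b]$. *)

(* Defs.v *)
From mathcomp Require Import all_boot.

(* Main.v *)
Require Import Defs.
From mathcomp Require Import all_boot all_order all_algebra.
From mathcomp Require Import all_classical all_reals all_analysis.
From mathcomp Require Import ring lra.
Import Order.TTheory GRing.Theory Num.Theory.
Import numFieldNormedType.Exports.
Local Open Scope classical_set_scope.
Local Open Scope ring_scope.

(** Write [F] for a primitive of [f] on [[a, b]].  For any real [p], the
    function [peano_term f f' F p], that is
    [x |-> (x - p)^2 / 2 * f' x - (x - p) * f x + F x], has derivative
    [(x - p)^2 / 2 * f'' x]: it is the result of integrating the latter by
    parts twice.  Put [m = y a + (1 - y) b], [q = b - d (b - a)] and
    [p = b - c (b - a)].  The expression inside the absolute value of the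
    theorem is [1 / (b - a)] times the sum of the increment of
    [peano_term f f' F q] over [[a, m]] and that of [peano_term f f' F p] over
    [[m, b]]; up to that factor it is the integral of [f''] against a piecewise
    quadratic kernel that switches from [q] to [p] at [m].

    Convexity of [|f''|] bounds [|f'' x|] by the chord joining the values at [a]
    and [b].  The derivatives of the two terms are therefore bounded by explicit
    cubic polynomials, and [A], [B] come from integrating these cubics.

    As [f''] is only a derivative, integrating it would require a fundamental
    theorem of calculus for discontinuous integrands.  The increments are
    compared by monotonicity instead: if [|g'| <= h'], then [h - g] and [h + g]
    are nondecreasing ([increment_le_dominating]), so only the continuous
    function [f] is ever integrated ([continuous_primitive]). *)

Section PeanoKernel.
Context {R : realType}.
Implicit Types (f F g h : R -> R) (a b c d p u v x y al be : R).

Lemma is_derive_derive1 g x : derivable g x 1 -> is_derive x 1 g (derive1 g x).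
Proof. by move=> dg; rewrite derive1E; exact/derivableP. Qed.

(** A mean value inequality, with the constant bound on [|g'|] replaced by the
    derivative of another function. *)
Lemma increment_le_dominating g h g' h' u v : u <= v ->
  {within `[u, v], continuous g} -> {within `[u, v], continuous h} ->
  (forall x, x \in `]u, v[ -> is_derive x 1 g (g' x)) ->
  (forall x, x \in `]u, v[ -> is_derive x 1 h (h' x)) ->
  (forall x, x \in `]u, v[ -> `|g' x| <= h' x) ->
  `|g v - g u| <= h v - h u.
Proof.
move=> uv cg ch dg dh gh.
have uI : u \in `[u, v] by rewrite in_itv/= lexx.
have vI : v \in `[u, v] by rewrite in_itv/= lexx uv.
have hBg : h u - g u <= h v - g v.
  apply: (@ger0_derive1_le_cc _ (h - g) u v) uI vI uv.
  - by move=> x xI; have ? := dg x xI; have ? := dh x xI.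
  - move=> x xI; have ? := dg x xI; have ? := dh x xI.
    rewrite derive1E derive_val subr_ge0.
    by apply: le_trans (gh x xI); exact: ler_norm.
  - exact: within_continuousB ch cg.
have hDg : h u + g u <= h v + g v.
  apply: (@ger0_derive1_le_cc _ (h + g) u v) uI vI uv.
  - by move=> x xI; have ? := dg x xI; have ? := dh x xI.
  - move=> x xI; have ? := dg x xI; have ? := dh x xI.
    rewrite derive1E derive_val -[g' x]opprK subr_ge0.
    by apply: le_trans (gh x xI); rewrite -normrN; exact: ler_norm.
  - exact: within_continuousD ch cg.
by rewrite ler_norml; apply/andP; split; lra.
Qed.

Lemma convex_le_chord g a b x : a < b -> convex_function `[a, b] g ->
  x \in `[a, b] ->
  g x <= (b - x) / (b - a) * g a + (x - a) / (b - a) * g b.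
Proof.
move=> ab cg; rewrite in_itv/= => /andP[ax xb].
have ba0 : 0 < b - a by rewrite subr_gt0.
have t0 : 0 <= (b - x) / (b - a) by rewrite divr_ge0 ?subr_ge0// ltW.
have t1 : (b - x) / (b - a) <= 1 by rewrite ler_pdivrMr// mul1r lerB.
have := cg (Itv01 t0 t1) a b.
rewrite !inE/= !in_itv/= !lexx (ltW ab)/= => /(_ isT isT).
rewrite [leRHS]convRE/=.
have -> : conv (Itv01 t0 t1) (a : convex_lmodType R^o) b = x.
  by rewrite [LHS](convRE a b)/= /unstable.onem; field; rewrite gt_eqF.
suff -> : unstable.onem ((b - x) / (b - a)) = (x - a) / (b - a) by [].
by rewrite /unstable.onem; field; rewrite gt_eqF.
Qed.

Lemma continuous_primitive f a b : a < b -> {within `[a, b], continuous f} ->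
  exists2 F : R -> R, {within `[a, b], continuous F} &
    (forall x, x \in `]a, b[ -> is_derive x 1 F (f x)) /\
    F b - F a = \int[lebesgue_measure]_(x in `[a, b]) f x.
Proof.
move=> ab cf.
have intf : lebesgue_measure.-integrable `[a, b] (EFin \o f).
  by apply: continuous_compact_integrable => //; exact: segment_compact.
exists (fun x => parameterized_integral lebesgue_measure a x f).
  exact: parameterized_integral_continuous (ltW ab) intf.
split; last first.
  by rewrite /parameterized_integral set_itv1 Rintegral_set1 subr0.
move=> x xI.
have [ax xb] : a < x /\ x < b by move: xI; rewrite in_itv/= => /andP.
have cfx := within_continuous_continuous ab cf xI.
have [dF F'f] := continuous_FTC1_closed xb intf ax cfx.
by rewrite -F'f; exact: is_derive_derive1.
Qed.

Definition peano_term f f' F p x : R :=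
  (x - p) ^+ 2 / 2 * f' x - (x - p) * f x + F x.

(** Product rule; the terms in [f' x] and [f x] cancel. *)
Lemma is_derive_peano_term f f' f'' F p x :
  is_derive x 1 f (f' x) -> is_derive x 1 f' (f'' x) ->
  is_derive x 1 F (f x) ->
  is_derive x 1 (peano_term f f' F p) ((x - p) ^+ 2 / 2 * f'' x).
Proof.
move=> Df Df' dF; rewrite /peano_term.
apply: is_derive_eq.
by rewrite /= /GRing.scale/=; field.
Qed.

Lemma is_derive_within_continuous f f' u v :
  (forall x, x \in `[u, v] -> is_derive x 1 f (f' x)) ->
  {within `[u, v], continuous f}.
Proof.
by move=> df; apply: derivable_within_continuous => x xI; have [] := df x xI.
Qed.

Lemma within_continuous_peano_term f f' F p (D : set R) :
  {within D, continuous f} -> {within D, continuous f'} ->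
  {within D, continuous F} -> {within D, continuous (peano_term f f' F p)}.
Proof.
move=> cf cf' cF.
have cp : {within D, continuous (fun x : R => x - p)}.
  apply: continuous_subspaceT => x.
  by apply: cvgB; [exact: cvg_id|exact: cvg_cst].
apply: within_continuousD cF; apply: within_continuousB.
  move=> x; apply: cvgM; last exact: cf'.
  by apply: cvgM; [apply: cvgM; exact: cp|exact: cvg_cst].
by move=> x; apply: cvgM; [exact: cp|exact: cf].
Qed.

(** The polynomial whose increments bound those of [peano_term] when
    [|f'' x| <= al + be * (x - p)]. *)
Definition majorant p al be x : R :=
  al * (x - p) ^+ 3 / 6 + be * (x - p) ^+ 4 / 8.

Lemma is_derive_majorant p al be x :
  is_derive x 1 (majorant p al be) ((x - p) ^+ 2 / 2 * (al + be * (x - p))).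
Proof.
rewrite /majorant; apply: is_derive_eq.
by rewrite /= /GRing.scale/=; field.
Qed.

Lemma peano_term_increment_le f f' f'' F p u v al be : u <= v ->
  (forall x, x \in `[u, v] -> is_derive x 1 f (f' x)) ->
  (forall x, x \in `[u, v] -> is_derive x 1 f' (f'' x)) ->
  {within `[u, v], continuous F} ->
  (forall x, x \in `]u, v[ -> is_derive x 1 F (f x)) ->
  (forall x, x \in `]u, v[ -> `|f'' x| <= al + be * (x - p)) ->
  `|peano_term f f' F p v - peano_term f f' F p u| <=
    majorant p al be v - majorant p al be u.
Proof.
move=> uv df df' cF dF f2.

have cT : {within `[u, v], continuous (peano_term f f' F p)}.
  apply: within_continuous_peano_term cF.
    exact: is_derive_within_continuous df.
  exact: is_derive_within_continuous df'.
have dT x : x \in `]u, v[ ->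
    is_derive x 1 (peano_term f f' F p) ((x - p) ^+ 2 / 2 * f'' x).
  move=> xI; have xI' : x \in `[u, v] by exact: subset_itv_oo_cc.
  by apply: is_derive_peano_term; [exact: df|exact: df'|exact: dF].
have cM : {within `[u, v], continuous (majorant p al be)}.
  apply: derivable_within_continuous => x _.
  by have [] := is_derive_majorant p al be x.
have dM x : x \in `]u, v[ -> is_derive x 1 (majorant p al be)
    ((x - p) ^+ 2 / 2 * (al + be * (x - p))).
  by move=> _; exact: is_derive_majorant.
apply: (increment_le_dominating _ _ _ _ u v uv cT cM dT dM) => x xI.
rewrite normrM ger0_norm ?divr_ge0 ?sqr_ge0//.
by apply: ler_wpM2l (f2 x xI); rewrite divr_ge0 ?sqr_ge0.
Qed.

(** The estimate of the theorem under the only consequence of convexity that it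
    uses, an affine bound on [|f''|]; the parameters [p] are chosen so that
    [(x - p)^2 / 2] becomes the kernel [(t - d)^2 / 2], resp. [(t - c)^2 / 2],
    under [x = t a + (1 - t) b]. *)
Lemma quadrature_error_le f f' f'' a b c y d M N : a < b -> 0 < y < 1 ->
  (forall x, x \in `[a, b] -> is_derive x 1 f (f' x)) ->
  (forall x, x \in `[a, b] -> is_derive x 1 f' (f'' x)) ->
  (forall x, x \in `[a, b] ->
     `|f'' x| <= (b - x) / (b - a) * M + (x - a) / (b - a) * N) ->
  `| ((c - y) ^+ 2 - (d - y) ^+ 2) / 2 * (a - b) * f' (y * a + (1 - y) * b)
     + ((d - 1) ^+ 2 * f' a - c ^+ 2 * f' b) / 2 * (a - b)
     + (c - d) * f (y * a + (1 - y) * b)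
     + ((d - 1) * f a - c * f b)
     + 1 / (b - a) * \int[lebesgue_measure]_(x in `[a, b]) f x |
  <= (b - a) ^+ 2 / 24 *
     ((6 * d ^+ 2 - 8 * d + 3 + (6 * c ^+ 2 - 6 * d ^+ 2) * y ^+ 2
           + (8 * d - 8 * c) * y ^+ 3) * M +
      (6 * d ^+ 2 - 4 * d + 1 + (12 * c ^+ 2 - 12 * d ^+ 2) * y
           + (12 * d + 6 * d ^+ 2 - 12 * c - 6 * c ^+ 2) * y ^+ 2
           + (8 * c - 8 * d) * y ^+ 3) * N).
Proof.
move=> ab /andP[y0 y1] df df' f2.
have ba0 : 0 < b - a by rewrite subr_gt0.
have ba_neq0 : b - a != 0 by rewrite gt_eqF.
have [F cF [dF <-]] :=
  continuous_primitive f a b ab (is_derive_within_continuous f f' a b df).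
set m := y * a + (1 - y) * b.
have am : a <= m by rewrite /m; nra.
have mb : m <= b by rewrite /m; nra.
(* The affine bound, expanded in powers of x - p. *)
pose al p := ((b - p) * M + (p - a) * N) / (b - a).
pose be := (N - M) / (b - a).
have affine p x : x \in `[a, b] -> `|f'' x| <= al p + be * (x - p).
  move=> xI; apply: le_trans (f2 x xI) _.
  rewrite le_eqVlt; apply/orP; left; apply/eqP.
  by rewrite /al /be; field.
have bound p u v : a <= u -> u <= v -> v <= b ->
  `|peano_term f f' F p v - peano_term f f' F p u| <=
    majorant p (al p) be v - majorant p (al p) be u.
  move=> au uv vb.
  have cc x : x \in `[u, v] -> x \in `[a, b].
    by rewrite !in_itv/= => /andP[? ?]; apply/andP; split; lra.
  have oo x : x \in `]u, v[ -> x \in `]a, b[.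
    by rewrite !in_itv/= => /andP[? ?]; apply/andP; split; lra.
  have df1 x : x \in `[u, v] -> is_derive x 1 f (f' x) by move=> /cc/df.
  have df2 x : x \in `[u, v] -> is_derive x 1 f' (f'' x) by move=> /cc/df'.
  have cF1 : {within `[u, v], continuous F} by exact: continuous_subspaceW cF.
  have dF1 x : x \in `]u, v[ -> is_derive x 1 F (f x) by move=> /oo/dF.
  have f21 x : x \in `]u, v[ -> `|f'' x| <= al p + be * (x - p).
    by move=> xI; apply/affine/cc/subset_itv_oo_cc.
  exact: (peano_term_increment_le _ _ _ _ _ _ _ _ _ uv df1 df2 cF1 dF1 f21).
pose q := b - d * (b - a); pose p := b - c * (b - a).
have bam := bound q a m (lexx a) am mb.
have bmb := bound p m b am mb (lexx b).
set E := (X in `|X| <= _).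
have -> : E = (peano_term f f' F q m - peano_term f f' F q a +
               (peano_term f f' F p b - peano_term f f' F p m)) / (b - a).
  rewrite /E /peano_term.
  move: (f m) (f' m) (F m) => fm f'm Fm.
  by rewrite /m /q /p; field.
rewrite normrM [`|_^-1|]gtr0_norm ?invr_gt0// ler_pdivrMr//.
apply: le_trans (ler_normD _ _) _; apply: le_trans (lerD bam bmb) _.
rewrite le_eqVlt; apply/orP; left; apply/eqP.
by rewrite /majorant /al /be /m /q /p; field.
Qed.

End PeanoKernel.

Lemma segment_sub_interior (R : realType) (I : set R) (a b : R) :
  is_interval I -> I° a -> I° b -> `[a, b] `<=` I°.
Proof.
move=> hI Ia Ib x; rewrite /= in_itv/= => /andP[].
rewrite le_eqVlt => /predU1P[<-//|ax].
rewrite le_eqVlt => /predU1P[->//|xb].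
have : `]a, b[ `<=` I°.
  rewrite -open_subsetE; last exact: interval_open.
  move=> z /=; rewrite in_itv/= => /andP[az zb].
  by apply: (hI a b); rewrite ?(ltW az) ?(ltW zb)//; exact: interior_subset.
by apply; rewrite /= in_itv/= ax.
Qed.

Theorem theorem8 (R : realType) (I : set R) (f : R -> R) (a b c y d : R)
    (hI : is_interval I)
    (hf : forall x : R, I° x -> derivable f x 1 /\ derivable (derive1 f) x 1)
    (ha : I° a) (hb : I° b) (hab : a < b)
    (hint : lebesgue_measure.-integrable `[a, b] (EFin \o derive1n 2 f))
    (hcyd : 0 <= c /\ c <= y /\ y <= d /\ d <= 1) (hy : 0 < y /\ y < 1)
    (hconv : convex_function `[a, b] (fun x => `|derive1n 2 f x|)) :
  let A := 6 * d ^+ 2 - 8 * d + 3 + (6 * c ^+ 2 - 6 * d ^+ 2) * y ^+ 2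
           + (8 * d - 8 * c) * y ^+ 3 in
  let B := 6 * d ^+ 2 - 4 * d + 1 + (12 * c ^+ 2 - 12 * d ^+ 2) * y
           + (12 * d + 6 * d ^+ 2 - 12 * c - 6 * c ^+ 2) * y ^+ 2
           + (8 * c - 8 * d) * y ^+ 3 in
  `| ((c - y) ^+ 2 - (d - y) ^+ 2) / 2 * (a - b) * derive1 f (y * a + (1 - y) * b)
     + ((d - 1) ^+ 2 * derive1 f a - c ^+ 2 * derive1 f b) / 2 * (a - b)
     + (c - d) * f (y * a + (1 - y) * b)
     + ((d - 1) * f a - c * f b)
     + 1 / (b - a) * \int[lebesgue_measure]_(x in `[a, b]) f x |
  <= (b - a) ^+ 2 / 24 * (A * `|derive1n 2 f a| + B * `|derive1n 2 f b|).
Proof.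
cbv zeta; case: hy => y0 y1.
have df x : x \in `[a, b] -> derivable f x 1 /\ derivable (derive1 f) x 1.
  by move=> xI; apply/hf/(segment_sub_interior _ _ _ _ hI ha hb).
apply: (quadrature_error_le f (derive1 f) (derive1n 2 f) a b c y d
          `|derive1n 2 f a| `|derive1n 2 f b| hab).
- by rewrite y0.
- by move=> x /df[dfx _]; exact: is_derive_derive1 dfx.
- by move=> x /df[_ df'x]; exact: is_derive_derive1 df'x.
- by move=> x xI; exact: (convex_le_chord _ _ _ _ hab hconv xI).
Qed.
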